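(* Suppose that $m\in\mathbb{N}^+$ and $G$ is a wide subgroup of $\mathbb{Q}^m$. Then for each at most countable abelian group $H$, the direct sum $K=G\oplus H$ admits a metric SSGP topology; that is, there is a metrizable topology $\mathscr{T}$ on $K$ such that $(K,\mathscr{T})$ is a topological group which is SSGP.
   Context: $\mathbb{N}^+$ is the set of positive integers. For a non-empty set $\pi$ of prime numbers, $\mathbb{Q}_\pi$ denotes the set of all rational numbers $q$ whose irreducible representation $q=z/n$ ($z\in\mathbb{Z}$, $n\in\mathbb{N}^+$) is such that all prime divisors of $n$ belong to $\pi$; also $\mathbb{Q}_\emptyset=\{0\}$. $\mathbb{Q}_\pi^m\subseteq\mathbb{Q}^m$ is the $m$-th Cartesian power. A subgroup $G$ of $\mathbb{Q}^m$ is called wide if $\mathbb{Z}^m\subseteq G$ and $G\setminus\mathbb{Q}_\pi^m\neq\emptyset$ for every finite set $\pi$ of prime numbers. For a subset $A$ of a group $K$, $\langle A\rangle$ is the smallest subgroup of $K$ containing $A$, $\langle x\rangle=\langle\{x\}\rangle$, and $\mathrm{Cyc}(A)=\{x\in K:\langle x\rangle\subseteq A\}$. A topological group $K$ is SSGP if $\langle \mathrm{Cyc}(U)\rangle$ is dense in $K$ for every neighbourhood $U$ of the identity of $K$. *)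

(* Defs.v *)
From HB Require Import structures.
From mathcomp Require Import all_boot all_order all_algebra.
From mathcomp Require Import all_classical all_reals all_analysis.

Set Implicit Arguments.
Unset Strict Implicit.
Unset Printing Implicit Defensive.

Import Order.TTheory GRing.Theory Num.Theory.

Local Open Scope classical_set_scope.
Local Open Scope ring_scope.

(* A subgroup of [V] is given as [G : zmodClosed V]; [subgroup_of G] is the
   underlying abelian group, as a type. *)
Record subgroup_of (V : zmodType) (G : zmodClosed V) :=
  Subgroup { sgval : V; sgvalP : sgval \in G }.

HB.instance Definition _ (V : zmodType) (G : zmodClosed V) :=
  [isSub for @sgval V G].
HB.instance Definition _ (V : zmodType) (G : zmodClosed V) :=
  [Choice of subgroup_of G by <:].
HB.instance Definition _ (V : zmodType) (G : zmodClosed V) :=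
  [SubChoice_isSubZmodule of subgroup_of G by <:].

(* The case [pi = set0] is a separate convention: the general clause would
   give the integers there. *)
Definition Qpi (pi : set nat) : set rat :=
  [set q | if pi == set0 then q = 0
           else forall p : nat, prime p -> (p %| `|denq q|)%N -> pi p].

Definition Qpi_pow (pi : set nat) (m : nat) : set 'rV[rat]_m :=
  [set v : 'rV[rat]_m | forall j, Qpi pi (v ord0 j)].

Definition Z_pow (m : nat) : set 'rV[rat]_m :=
  [set v : 'rV[rat]_m | forall j, v ord0 j \is a Num.int].

Definition wide (m : nat) (G : set 'rV[rat]_m) : Prop :=
  @Z_pow m `<=` G /\
  forall pi : set nat, finite_set pi -> pi `<=` [set p | prime p] ->
    G `\` @Qpi_pow pi m !=set0.

Definition gen (V : zmodType) (A : set V) : set V :=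
  smallest [set B : set V | zmod_closed (mem B)] A.

Definition Cyc (V : zmodType) (A : set V) : set V :=
  [set x | gen [set x] `<=` A].

Definition SSGP (V : topologicalZmodType) : Prop :=
  forall U : set V, nbhs 0 U -> dense (gen (Cyc U)).

Definition metrizable (R : realType) (T : topologicalType) : Prop :=
  exists M : metricType R, (M : topologicalType) = T.

(* Equality of the bundled [zmodType]s: the topological group [V] has the same
   carrier and the same group operations as [K]. *)
Definition admits_metric_SSGP (R : realType) (K : zmodType) : Prop :=
  exists V : topologicalZmodType,
    [/\ (V : zmodType) = K, metrizable R V & SSGP V].

(* Main.v *)
(* Write A = Z^m x H and B = Z^m x 0, and let x_0, x_1, ... list K = G x H with
   every element occurring at arbitrarily large indices. Wideness gives, for
   infinitely many primes p, some u_p in G outside Z^m with p u_p in Z^m. At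
   stage n choose n + 2 new primes p_{n,i}, larger than n + 1 and prime to the
   orders of x_0, ..., x_n modulo A, and put c_{n,i} = (n+1)! u_{p_{n,i}} and
   e_n = x_n - sum_i c_{n,i}. Take the largest group seminorm with
   |z c_{n,i}| <= 1/(n+1) for all integers z, and |e_n| <= 1/(n+1). Each x_n is
   then within 1/(n+1) of a sum of elements generating cyclic groups inside the
   ball of radius 1/(n+1), which is the SSGP property.

   The seminorm is a norm: let y = x_j be nonzero, n0 >= j and y not in
   (n0+1)! B, and suppose y has a representation
   sum_n (sum_i m_{n,i} c_{n,i} + k_n e_n) of cost less than 1/(n0+1). The
   stages below n0 are absent. At a stage n >= n0 the cost leaves some m_{n,i}
   zero and |k_n| <= n. Working down from the top stage and localising at
   p_{n,i}, one gets p_{n,i} | m_{n,i} - k_n for all i; hence k_n = 0, all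
   p_{n,i} divide m_{n,i}, and stage n lies in (n+1)! B. So y lies in
   (n0+1)! B, a contradiction. *)

Require Import Defs.
From HB Require Import structures.
From mathcomp Require Import all_boot all_order all_algebra.
From mathcomp Require Import all_classical all_reals all_analysis.
From mathcomp Require Import zify.

Set Implicit Arguments.
Unset Strict Implicit.
Unset Printing Implicit Defensive.

Import Order.TTheory GRing.Theory Num.Theory.

Local Open Scope classical_set_scope.
Local Open Scope ring_scope.

(** * Group norms and the metrizable group topologies they induce *)

Record group_norm (R : realType) (K : zmodType) := GroupNorm {
  gpnorm :> K -> R ;
  gpnorm0 : gpnorm 0 = 0 ;
  gpnorm0_eq0 : forall x, gpnorm x = 0 -> x = 0 ;
  gpnormN : forall x, gpnorm (- x) = gpnorm x ;
  gpnormD : forall x y, gpnorm (x + y) <= gpnorm x + gpnorm y }.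

(** An alias of [K] that mentions [N], so that the topology inferred on it can depend on the
    norm. *)
Definition normed_by (R : realType) (K : zmodType) (N : group_norm R K) :
  Type := K.

HB.instance Definition _ (R : realType) (K : zmodType) (N : group_norm R K) :=
  GRing.Zmodule.copy (normed_by N) K.

Lemma gpnorm_distxx (R : realType) (K : zmodType) (N : group_norm R K)
  (x : normed_by N) : N (x - x) = 0.
Proof. by rewrite subrr gpnorm0. Qed.

Lemma gpnorm_dist_eq0 (R : realType) (K : zmodType) (N : group_norm R K)
  (x y : normed_by N) : N (x - y) = 0 -> x = y.
Proof. by move=> /gpnorm0_eq0/subr0_eq. Qed.

Lemma gpnorm_distC (R : realType) (K : zmodType) (N : group_norm R K)
  (x y : normed_by N) : N (x - y) = N (y - x).
Proof. by rewrite -gpnormN opprB. Qed.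

Lemma gpnorm_dist_triangle (R : realType) (K : zmodType) (N : group_norm R K)
  (y x z : normed_by N) : N (x - z) <= N (x - y) + N (y - z).
Proof. by rewrite -(subrKA y x (- z)); exact: gpnormD. Qed.

HB.instance Definition _ (R : realType) (K : zmodType) (N : group_norm R K) :=
  isMetric.Build R (normed_by N) (@gpnorm_distxx R K N) (@gpnorm_dist_eq0 R K N)
    (@gpnorm_distC R K N) (@gpnorm_dist_triangle R K N).

Lemma normed_by_ballE (R : realType) (K : zmodType) (N : group_norm R K)
  (x y : normed_by N) (e : R) : ball x e y = is_true (N (x - y) < e).
Proof. by rewrite ballEmdist. Qed.

Lemma normed_by_sub_continuous (R : realType) (K : zmodType)
    (N : group_norm R K) :
  continuous (fun x : normed_by N * normed_by N => x.1 - x.2).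
Proof.
move=> [x y]; apply/(@cvg_ballP R) => e e0.
have e20 : 0 < e / 2 by rewrite divr_gt0.
exists (ball x (e / 2), ball y (e / 2)) => /=.
  by split; apply: nbhsx_ballx.
move=> [x' y'] /= [xx' yy']; rewrite normed_by_ballE.
rewrite !normed_by_ballE in xx' yy'.
rewrite opprD addrACA -opprD (splitr e).
by rewrite (le_lt_trans (gpnormD _ _ _))// ltrD// gpnormN.
Qed.

HB.instance Definition _ (R : realType) (K : zmodType) (N : group_norm R K) :=
  PreTopologicalNmodule_isTopologicalZmodule.Build (normed_by N)
    (@normed_by_sub_continuous R K N).

(** * Generated subgroups and the SSGP property for a norm *)

Lemma gen_set1 (V : zmodType) (x : V) :
  gen [set x] `<=` [set y | exists z : int, y = x *~ z].
Proof.
apply: smallest_sub; last by move=> _ ->; exists 1; rewrite mulr1z.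
split=> [|y z]; first by rewrite inE /=; exists 0; rewrite mulr0z.
rewrite !inE => -[a ->] [b ->]; exists (a - b).
by rewrite mulrzBr.
Qed.

Lemma gen_sum (V : zmodType) (A : set V) (n : nat) (c : 'I_n -> V) :
  (forall i, A (c i)) -> gen A (\sum_(i < n) c i).
Proof.
move=> Ac B [[B0 BB] AB].
apply: (big_ind B) => [|x y Bx By|i _]; last exact/AB/Ac.
  by move: B0; rewrite inE.
have BN : B (- y).
  by rewrite -sub0r; have := BB 0 y B0; rewrite !inE; apply.
by rewrite -(opprK y); have := BB x (- y); rewrite !inE; apply.
Qed.

Lemma normed_by_zmodE (R : realType) (K : zmodType) (N : group_norm R K) :
  (normed_by N : zmodType) = K.
(* [K] has to be destructed: without eta for the structure record the copied
   structure is not convertible to a variable. *)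
Proof. by case: K N => T []. Qed.

(** Once all multiples of [c i] stay in a ball contained in [U], [c i] lies in [Cyc U]; the sum
    approximating [x] then lies in [gen (Cyc U)], which gives density. *)
Lemma gpnorm_admits_metric_SSGP (R : realType) (K : zmodType)
    (N : group_norm R K) :
  (forall (x : K) (e : R), 0 < e -> exists n (c : 'I_n -> K),
    (forall i z, N (c i *~ z) < e) /\ N (x - \sum_(i < n) c i) < e) ->
  admits_metric_SSGP R K.
Proof.
move=> approx; exists (normed_by N); split.
- exact: normed_by_zmodE.
- by exists (normed_by N).
- move=> U /nbhs_ballP[d /= d0 dU] O [x Ox] oO.
have /nbhs_ballP[e /= e0 eO] : nbhs x O by exact: open_nbhs_nbhs.
have [|n [c [cN cx]]] := approx x (Num.min d e).
  by rewrite lt_min d0.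
exists (\sum_(i < n) c i); split.
  by apply: eO; rewrite normed_by_ballE (lt_le_trans cx)// ge_min lexx orbT.
apply: gen_sum => i y /gen_set1[z ->]; apply: dU.
by rewrite normed_by_ballE sub0r gpnormN (lt_le_trans (cN i z))// ge_min lexx.
Qed.

(** * From costs to a norm *)

(** The norm is the infimum of the costs; the positive lower bound at each nonzero element makes it
    definite. *)
Lemma group_norm_of_cost (R : realType) (K : zmodType) (rep : K -> R -> Prop) :
  rep 0 0 ->
  (forall x a, rep x a -> 0 <= a) ->
  (forall x a, rep x a -> rep (- x) a) ->
  (forall x y a b, rep x a -> rep y b -> rep (x + y) (a + b)) ->
  (forall x, exists a, rep x a) ->
  (forall x, x != 0 -> exists2 d : R, 0 < d & forall a, rep x a -> d <= a) ->
  exists N : group_norm R K, forall x a, rep x a -> N x <= a.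
Proof.
move=> rep0 rep_ge0 repN repD rep_ex rep_sep.
pose N x := inf [set a | rep x a].
have repne x : [set a | rep x a] !=set0 by have [a xa] := rep_ex x; exists a.
have replb x : has_lbound [set a | rep x a] by exists 0 => a; exact: rep_ge0.
have N_le x a : rep x a -> N x <= a by exact: ge_inf.
have N_ge0 x : 0 <= N x by apply: lb_le_inf => // a; exact: rep_ge0.
have NN x : N (- x) <= N x.
  by apply: lb_le_inf => // a xa; apply: N_le; exact: repN.
suff [Nm NmE] : exists N' : group_norm R K, gpnorm N' = N.
  by exists Nm => x a; rewrite NmE; exact: N_le.
unshelve eexists; first (apply: (@GroupNorm R K N)).
- by apply/eqP; rewrite eq_le N_ge0 N_le.
- move=> x Nx0; apply/eqP/negPn/negP => /rep_sep[d d0 dx].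
  have : d <= N x by exact: lb_le_inf.
  by rewrite Nx0 leNgt d0.
- by move=> x; apply/eqP; rewrite eq_le NN/= -{1}(opprK x) NN.
- move=> x y; rewrite -lerBlDr; apply: lb_le_inf => // a xa.
  rewrite lerBlDr [leRHS]addrC -lerBlDr; apply: lb_le_inf => // b yb.
  by rewrite lerBlDr [leRHS]addrC N_le//; exact: repD.
- by [].
Qed.

(** * Costs of representations by generators and error terms *)

Definition stage (K : zmodType) (x : nat -> K) (c : nat -> nat -> K)
    (m : nat -> nat -> int) (k : nat -> int) (n : nat) : K :=
  \sum_(i < n.+2) c n i *~ m n i + (x n - \sum_(i < n.+2) c n i) *~ k n.

(** A nonzero [m n i] counts once whatever its size, since whole cyclic groups have to stay small;
    the error term is charged for each unit of [k n]. *)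
Definition stage_weight (m : nat -> nat -> int) (k : nat -> int)
    (n : nat) : nat :=
  (\sum_(i < n.+2) (m n i != 0)%R + `|k n|)%N.

Definition stage_cost (R : realType) (m : nat -> nat -> int) (k : nat -> int)
  (n : nat) : R := (stage_weight m k n)%:R / n.+1%:R.

(** Finite sums are encoded by total coefficient functions: the equation at every [L >= L0] makes
    later stages vanish, and two representations can be added past a common bound. *)
Definition has_cost (R : realType) (K : zmodType) (x : nat -> K)
    (c : nat -> nat -> K) (y : K) (a : R) : Prop :=
  exists m k L0, forall L, (L0 <= L)%N ->
    y = \sum_(n < L) stage x c m k n /\ \sum_(n < L) stage_cost R m k n <= a.

Section HasCost.
Context (R : realType) (K : zmodType) (x : nat -> K) (c : nat -> nat -> K).

Lemma has_cost0 : has_cost x c 0 (0 : R).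
Proof.
exists (fun _ _ => 0), (fun=> 0), 0%N => L _; split.
  by rewrite big1// => n _; rewrite /stage mulr0z addr0 big1.
by rewrite big1// => n _; rewrite /stage_cost /stage_weight big1 ?mul0r.
Qed.

Lemma stage_cost_ge0 m k n : 0 <= stage_cost R m k n.
Proof. by rewrite divr_ge0. Qed.

Lemma has_cost_ge0 y (a : R) : has_cost x c y a -> 0 <= a.
Proof.
move=> [m [k [L0 /(_ L0 (leqnn _))[_]]]]; apply: le_trans.
by apply: sumr_ge0 => n _; exact: stage_cost_ge0.
Qed.

Lemma has_costN y (a : R) : has_cost x c y a -> has_cost x c (- y) a.
Proof.
move=> [m [k [L0 ya]]].
exists (fun n i => - m n i), (fun n => - k n), L0 => L /ya[-> ca]; split.
  rewrite -sumrN; apply: eq_bigr => n _; rewrite /stage mulrNz opprD; congr +%R.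
  by rewrite -sumrN; apply: eq_bigr => i _; rewrite mulrNz.
apply: le_trans ca; apply: ler_sum => n _; rewrite /stage_cost /stage_weight.
rewrite abszN (eq_bigr (fun i : 'I__ => (m n i != 0 : nat)))// => i _.
by rewrite oppr_eq0.
Qed.

Lemma stage_weightD m k m' k' n :
  (stage_weight (fun n i => m n i + m' n i)%R (fun n => k n + k' n)%R n
   <= stage_weight m k n + stage_weight m' k' n)%N.
Proof.
rewrite /stage_weight addnACA leq_add//; last by lia.
rewrite -big_split leq_sum//= => i _.
have [->|_] := eqVneq (m n i) 0; first by rewrite add0r.
by apply: leq_trans (leq_b1 _) _; rewrite add1n.
Qed.

Lemma has_costD y z (a b : R) :
  has_cost x c y a -> has_cost x c z b -> has_cost x c (y + z) (a + b).
Proof.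
move=> [m [k [L0 ya]]] [m' [k' [L0' zb]]].
exists (fun n i => m n i + m' n i), (fun n => k n + k' n), (maxn L0 L0') => L.
rewrite geq_max => /andP[/ya[-> ca] /zb[-> cb]]; split.
  rewrite -big_split; apply: eq_bigr => n _ /=; rewrite /stage mulrzDr addrACA.
  by congr +%R; rewrite -big_split; apply: eq_bigr => i _; rewrite mulrzDr.
apply: le_trans (lerD ca cb); rewrite -big_split; apply: ler_sum => n _ /=.
by rewrite -mulrDl ler_wpM2r// -natrD ler_nat stage_weightD.
Qed.

Lemma has_cost_stage m k n :
  (forall n', n' != n -> (forall i, m n' i = 0) /\ k n' = 0) ->
  has_cost x c (stage x c m k n) (stage_cost R m k n).
Proof.
move=> mk0; exists m, k, n.+1 => L nL.
have E0 n' : n' != n -> stage x c m k n' = 0 /\ stage_cost R m k n' = 0.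
  move=> /mk0[m0 k0]; rewrite /stage /stage_cost /stage_weight k0 mulr0z.
  rewrite !big1 ?mul0r ?addr0// => i _; first by rewrite m0 eqxx.
  by rewrite m0 mulr0z.
split; rewrite (bigD1 (Ordinal nL))//= big1 ?addr0// => i ni.
  by have [] := E0 i ni.
by have [] := E0 i ni.
Qed.

Lemma has_cost_cyclic n i z : (i < n.+2)%N ->
  has_cost x c (c n i *~ z) (n.+1%:R^-1 : R).
Proof.
move=> ni.
pose m n' i' : int := if (n' == n) && (i' == i) then z else 0.
have := @has_cost_stage m (fun=> 0) n.
have -> : stage x c m (fun=> 0) n = c n i *~ z.
  rewrite /stage mulr0z addr0 (bigD1 (Ordinal ni))//= /m !eqxx/= big1 ?addr0//.
  by move=> j ji; rewrite ifN// mulr0z.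
have w1 : (stage_weight m (fun=> 0) n <= 1)%N.
  rewrite /stage_weight addn0 (bigD1 (Ordinal ni))//= big1 ?addn0 ?leq_b1//.
  by move=> j ji; rewrite /m (negbTE (ji : j != i :> nat)) andbF eqxx.
case=> [n' /negbTE n'n|m' [k' [L0 yc]]]; first by rewrite /m n'n.
exists m', k', L0 => L /yc[-> cc]; split => //; apply: le_trans cc _.
by rewrite /stage_cost -[leRHS]mul1r ler_wpM2r// (ler_nat _ _ 1).
Qed.

Lemma has_cost_error n :
  has_cost x c (x n - \sum_(i < n.+2) c n i) (n.+1%:R^-1 : R).
Proof.
pose k n' : int := if (n' == n) then 1 else 0.
have := @has_cost_stage (fun _ _ => 0) k n.
have -> : stage x c (fun _ _ => 0) k n = x n - \sum_(i < n.+2) c n i.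
  by rewrite /stage /k eqxx mulr1z big1 ?add0r// => i _; rewrite mulr0z.
have -> : stage_cost R (fun _ _ => 0) k n = n.+1%:R^-1.
  rewrite /stage_cost /stage_weight /k big1 => [|i _]; last by rewrite eqxx.
  by rewrite eqxx mul1r.
by apply=> n' /negbTE n'n; rewrite /k n'n.
Qed.

Lemma has_cost_ex y : (exists n, x n = y) -> exists a : R, has_cost x c y a.
Proof.
move=> [n <-].
suff [a ca] : exists a : R, has_cost x c (\sum_(i < n.+2) c n i) a.
  rewrite -(subrK (\sum_(i < n.+2) c n i) (x n)).
  by eexists; apply: has_costD ca; exact: has_cost_error.
apply: (big_ind (fun y => exists a : R, has_cost x c y a)).
- by exists 0; exact: has_cost0.
- by move=> ? ? [a ca] [b cb]; exists (a + b); exact: has_costD.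
- by move=> i _; eexists; rewrite -[c n i]mulr1z; exact: has_cost_cyclic.
Qed.

End HasCost.

(** * Localisation modulo a subgroup, and factorial multiples *)

(** For [q] prime, this is the kernel of the map from [K] to the localisation of [K / A] at [q]. *)
Definition local_at (K : zmodType) (A : zmodClosed K) (q : nat) : {pred K} :=
  fun y => `[< exists2 d : nat, coprime q d & y *+ d \in A >].

Lemma local_at_zmod_closed (K : zmodType) (A : zmodClosed K) (q : nat) :
  zmod_closed (local_at A q).
Proof.
split; first by apply/asboolP; exists 1%N; rewrite ?coprimen1// mulr1n rpred0.
move=> y z /asboolP[d qd yd] /asboolP[d' qd' zd']; apply/asboolP.
exists (d * d')%N; first by rewrite coprimeMr qd.
by rewrite mulrnBl mulrnA mulnC mulrnA rpredB// rpredMn.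
Qed.

HB.instance Definition _ (K : zmodType) (A : zmodClosed K) (q : nat) :=
  GRing.isZmodClosed.Build K (local_at A q) (local_at_zmod_closed A q).

Lemma mem_local_at (K : zmodType) (A : zmodClosed K) (q d : nat) (y : K) :
  coprime q d -> y *+ d \in A -> y \in local_at A q.
Proof. by move=> qd yd; apply/asboolP; exists d. Qed.

(** If [p] did not divide [z], some multiple of [u] by an integer prime to [p] would lie in [A]; as
    [u *+ p] does too, Bezout would put [u] in [A]. *)
Lemma local_at_dvd (K : zmodType) (A : zmodClosed K) (p n : nat) (u : K)
    (z : int) :
  prime p -> u \notin A -> u *+ p \in A -> coprime p n ->
  u *+ n *~ z \in local_at A p -> (p %| `|z|)%N.
Proof.
move=> p_pr uA upA pn /asboolP[d pd udA]; apply: contraNT uA => pz.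
have pt : coprime p (n * `|z| * d).
  by rewrite !coprimeMr pn pd andbT prime_coprime.
have utA : u *+ (n * `|z| * d) \in A.
  rewrite mulrnA mulrnA; move: udA; case: (z) => k //.
  by rewrite NegzE mulrNz mulNrn rpredN.
have t0 : (0 < p)%N by exact: prime_gt0.
have [a b ab _] := egcdnP (n * `|z| * d) t0.
rewrite (eqP pt) in ab.
have -> : u = u *+ p *+ a - u *+ (n * `|z| * d) *+ b.
  by rewrite -!mulrnA [(p * a)%N]mulnC ab addn1 mulrS [(b * _)%N]mulnC addrK.
by rewrite rpredB// rpredMn.
Qed.

Definition fact_multiples (K : zmodType) (B : zmodClosed K) (n : nat) :
    {pred K} :=
  fun y => `[< exists2 b, b \in B & y = b *+ n.+1`! >].

Lemma fact_multiples_zmod_closed (K : zmodType) (B : zmodClosed K) (n : nat) :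
  zmod_closed (fact_multiples B n).
Proof.
split; first by apply/asboolP; exists 0; rewrite ?rpred0// mul0rn.
move=> y z /asboolP[b bB ->] /asboolP[b' bB' ->]; apply/asboolP.
by exists (b - b'); [rewrite rpredB|rewrite mulrnBl].
Qed.

HB.instance Definition _ (K : zmodType) (B : zmodClosed K) (n : nat) :=
  GRing.isZmodClosed.Build K (fact_multiples B n)
    (fact_multiples_zmod_closed B n).

Lemma fact_multiples_anti (K : zmodType) (B : zmodClosed K) (n n' : nat)
    (y : K) :
  (n <= n')%N -> y \in fact_multiples B n' -> y \in fact_multiples B n.
Proof.
move=> nn' /asboolP[b bB ->]; apply/asboolP.
have /dvdnP[k ->] : (n.+1`! %| n'.+1`!)%N
  by rewrite -(@bin_fact n'.+1 n.+1)// mulnCA dvdn_mulr.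
by exists (b *+ k); rewrite ?rpredMn// mulrnA.
Qed.

Lemma prime_coprime_fact p n : prime p -> (n < p)%N -> coprime p n`!.
Proof.
move=> p_pr; elim: n => [|n IH] np; first by rewrite fact0 coprimen1.
rewrite factS coprimeMr IH ?(ltnW np)// andbT prime_coprime//.
by rewrite gtnNdvd.
Qed.

(** * Choice of the primes and enumeration of the group *)

(** Pairs are coded by natural numbers, and good values are picked in strictly increasing order
    along the codes, each above the bound for its pair. *)
Lemma choose_distinct (good : nat -> Prop) (b : nat -> nat) :
  (forall n, exists2 p, good p & (n < p)%N) ->
  exists p : nat -> nat -> nat,
    [/\ forall n i, good (p n i), forall n i, (b n < p n i)%N &
        forall n i n' i', p n i = p n' i' -> n = n' /\ i = i'].
Proof.
move=> good_unb.
have [f fP] : {f : nat -> nat & forall n, good (f n) /\ (n < f n)%N}.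
  apply: (@choice _ _ (fun n p => good p /\ (n < p)%N)) => n.
  by have [p] := good_unb n; exists p.
pose B s := b (odflt (0%N, 0%N) (unpickle s)).1.
pose q := fix q s := if s is s'.+1 then f (maxn (q s') (B s)) else f (B 0%N).
have qlt : {homo q : s t / (s < t)%N}.
  apply: homo_ltn => [x y z|s]; first exact: ltn_trans.
  have [_ /=] := fP (maxn (q s) (B s.+1)).
  by apply: leq_ltn_trans; rewrite leq_maxl.
have qinj : injective q.
  by move=> s t qst; case: (ltngtP s t) => // /qlt; rewrite qst ltnn.
exists (fun n i => q (pickle (n, i))); split => [n i|n i|n i n' i' /qinj].
- by case: pickle => [|s]; exact: (fP _).1.
- have -> : b n = B (pickle (n, i)) by rewrite /B pickleK.
  case: pickle => [|s] /=; first exact: (fP _).2.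
  by apply: leq_ltn_trans (fP _).2; rewrite leq_maxr.
- by move/(pcan_inj pickleK) => [-> ->].
Qed.

Lemma enumerate_cofinally (K : zmodType) : countable [set: K] ->
  exists x : nat -> K, forall y N, exists2 n, (N <= n)%N & x n = y.
Proof.
move=> /countable_injP[f finj].
have {}finj : injective f by move=> y z; apply: finj; rewrite inE.
pose g n := xget 0 [set y | f y = n].
have gf y : g (f y) = y.
  by apply: finj; rewrite /g; case: xgetP => [z _ ->|/(_ y) []].
(* Indices are read through their 2-adic valuation, so [y] sits at every odd multiple of [2 ^ f y];
   the odd factor pushes the index past [N]. *)
exists (fun n => g (logn 2 n)) => y N; exists (2 ^ f y * N.*2.+1)%N.
  have : (0 < 2 ^ f y)%N by rewrite expn_gt0.
  nia.
rewrite lognM ?expn_gt0// pfactorK// (@lognE 2 N.*2.+1) dvdn2.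
by rewrite /= odd_double addn0 gf.
Qed.

(** * Lower bound for the costs of a nonzero element *)

Section Separation.
Context (K : zmodType) (A B : zmodClosed K) (x : nat -> K)
  (p : nat -> nat -> nat) (u : nat -> nat -> K).
Hypotheses (BA : {subset B <= A}) (p_prime : forall n i, prime (p n i))
  (p_gt : forall n i, (n.+1 < p n i)%N)
  (p_inj : forall n i n' i', p n i = p n' i' -> n = n' /\ i = i')
  (x_local : forall n i j, (j <= n)%N -> x j \in local_at A (p n i))
  (uA : forall n i, u n i \notin A) (upB : forall n i, u n i *+ p n i \in B).

Let c n i := u n i *+ n.+1`!.

Lemma mem_local_at_sub q y : y \in B -> y \in local_at A q.
Proof. by move=> /BA yA; apply: (mem_local_at (coprimen1 q)). Qed.

Lemma fact_multiples_local q n y :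
  y \in fact_multiples B n -> y \in local_at A q.
Proof. by move=> /asboolP[b bB ->]; rewrite mem_local_at_sub// rpredMn. Qed.

(** Modulo [A], [c n' i'] is killed by [p n' i'], a prime different from [p n i]. *)
Lemma generator_local n i n' i' : (n', i') != (n, i) ->
  c n' i' \in local_at A (p n i).
Proof.
move=> ne; apply: (@mem_local_at _ _ _ (p n' i')).
  rewrite prime_coprime// dvdn_prime2//.
  by apply: contraNN ne => /eqP/p_inj[-> ->].
by rewrite /c mulrnAC rpredMn// BA.
Qed.

Lemma stage_low_local m k n i n' : (n' < n)%N ->
  stage x c m k n' \in local_at A (p n i).
Proof.
move=> n'n; have c_loc i' : c n' i' \in local_at A (p n i).
  by rewrite generator_local// xpair_eqE ltn_eqF.
rewrite rpredD//; first by apply: rpred_sum => i' _; rewrite rpredMz.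
by rewrite rpredMz// rpredB ?x_local 1?ltnW//; apply: rpred_sum => i' _.
Qed.

(** After regrouping by generators, every term but the multiple [m n i - k n] of [c n i] is local at
    [p n i], so this one is too; the factorial in [c n i] is prime to [p n i] because
    [n.+1 < p n i]. *)
Lemma stage_dvd m k n i : (i < n.+2)%N ->
  stage x c m k n \in local_at A (p n i) -> (p n i %| `|m n i - k n|)%N.
Proof.
move=> ni; set q := p n i.
have -> : stage x c m k n =
    \sum_(i' < n.+2) c n i' *~ (m n i' - k n) + x n *~ k n.
  rewrite /stage mulrzBl addrA addrAC; congr +%R; rewrite mulrz_suml -sumrB.
  by apply: eq_bigr => j _; rewrite mulrzBr.
rewrite (bigD1 (Ordinal ni))//= -addrA rpredDr; last first.
  rewrite rpredD ?rpredMz ?x_local//; apply: rpred_sum => j ji.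
  by rewrite rpredMz// generator_local// xpair_eqE eqxx/=.
apply: (@local_at_dvd _ _ _ n.+1`! (u n i)) => //; first exact: p_prime.
  exact: BA (upB n i).
by apply: prime_coprime_fact; [exact: p_prime|exact: p_gt].
Qed.

Lemma stage_fact_multiples m k n :
  (stage_weight m k n <= n)%N ->
  (forall i, stage x c m k n \in local_at A (p n i)) ->
  stage x c m k n \in fact_multiples B n.
Proof.
move=> wn sn.
have dv i : (i < n.+2)%N -> (p n i %| `|m n i - k n|)%N.
  by move/stage_dvd; exact.
have kn : (`|k n| <= n)%N by rewrite (leq_trans _ wn)// leq_addl.
have k0 : k n = 0.
  (* Pigeonhole: [n.+2] coefficients against a weight of at most [n]. The zero one makes [p n j]
     divide [k n], which is too small to be nonzero. *)
  have [j mj] : exists j : 'I_n.+2, m n j = 0.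
    apply: contrapT => /forallNP mN.
    suff : (n.+2 <= n)%N by lia.
    apply: leq_trans wn; rewrite -[leqLHS]card_ord -sum1_card.
    by apply: leq_trans (leq_addr _ _); apply: leq_sum => i _; case: eqP (mN i).
  have := dv j (ltn_ord j); rewrite mj sub0r abszN => pk.
  apply/eqP; rewrite -absz_eq0; apply: contraLR pk; rewrite -lt0n => k_gt0.
  by rewrite gtnNdvd// (leq_ltn_trans kn)// ltnW.
rewrite /stage k0 mulr0z addr0; apply: rpred_sum => i _.
have := dv i (ltn_ord i); rewrite k0 subr0 => /dvdnP[t mt].
suff cB (s : nat) : c n i *+ (s * p n i) \in fact_multiples B n.
  case: (m n i) mt => [s|s]; rewrite ?NegzE ?abszN/= => ->; first exact: cB.
  by rewrite mulrNz rpredN; exact: cB.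
apply/asboolP; exists (u n i *+ p n i *+ s); first by rewrite rpredMn.
by rewrite /c mulnC mulrnA [in LHS]mulrnAC -!mulrnA; congr (_ *+ _); lia.
Qed.

Lemma has_cost_ge (R : realType) (y : K) (n0 j : nat) (a : R) :
  (j <= n0)%N -> y = x j -> y \notin fact_multiples B n0 ->
  has_cost x c y a -> n0.+1%:R^-1 <= a.
Proof.
move=> jn0 yx yB [m [k [L0 rep]]]; rewrite leNgt; apply: contra yB => a_lt.
(* Taking [L] at least [n0] makes the cost bound available at all stages below [n0]. *)
have [yS Sa] := rep (maxn L0 n0) (leq_maxl _ _).
set L := maxn _ _ in yS Sa.
have cost_lt n : (n < L)%N ->
    (stage_weight m k n)%:R * n0.+1%:R < (n.+1%:R : R).
  move=> nL; have : stage_cost R m k n <= a.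
    apply: le_trans Sa; rewrite (bigD1 (Ordinal nL))//= lerDl.
    by apply: sumr_ge0 => i _; exact: stage_cost_ge0.
  move=> /le_lt_trans/(_ a_lt); rewrite /stage_cost.
  by rewrite ltr_pdivrMr// mulrC ltr_pdivlMr.
(* The weight times [n0.+1] is below [n.+1 <= n0], so the weight is zero. *)
have low n : (n < n0)%N -> stage x c m k n = 0.
  move=> nn0; have /cost_lt : (n < L)%N by rewrite leq_max nn0 orbT.
  rewrite -natrM ltr_nat => w.
  have w0 : stage_weight m k n = 0%N by nia.
  move: w0; rewrite /stage_weight => /eqP.
  rewrite addn_eq0 sum_nat_eq0 absz_eq0.
  move=> /andP[/forallP m0 /eqP k0]; rewrite /stage k0 mulr0z addr0.
  rewrite big1// => i _.
  by have := m0 i; rewrite eqb0 negbK => /eqP ->; rewrite mulr0z.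
(* Descending induction from the top: stage [n] is [y] minus the other stages, of which the lower
   ones are local at [p n i] and the higher ones already lie in [B]. *)
have high n : (n0 <= n < L)%N -> stage x c m k n \in fact_multiples B n.
  have [t] := ubnP (L - n)%N; elim: t n => // t IH n Lnt /andP[n0n nL].
  apply: stage_fact_multiples => [|i].
    by have := cost_lt n nL; rewrite -natrM ltr_nat; nia.
  have : y \in local_at A (p n i) by rewrite yx x_local// (leq_trans jn0).
  rewrite yS (bigD1 (Ordinal nL))//= rpredDr//; apply: rpred_sum => n' n'n.
  have := ltn_ord n'; case: (ltngtP n' n) => [n'_lt|n_lt n'L|n'E].
  - by move=> _; exact: stage_low_local.
  - by apply: (@fact_multiples_local _ n'); apply: IH; lia.
  - by move: n'n; rewrite -val_eqE/= n'E eqxx.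
rewrite yS; apply: rpred_sum => n _; case: (ltnP n n0) => [/low ->|n0n].
  exact: rpred0.
by apply: (fact_multiples_anti n0n); apply: high; rewrite n0n ltn_ord.
Qed.

End Separation.

(** * An algebraic criterion *)

(** Torsion of [K / A] makes each [x j] local at all large primes, elements of order [p] modulo [A]
    supply the generators, and the trivial intersection of the factorial multiples of [B] separates
    points. *)
Lemma admits_metric_SSGP_criterion (R : realType) (K : zmodType)
    (A B : zmodClosed K) :
  countable [set: K] -> {subset B <= A} ->
  (forall y : K, exists2 d : nat, (0 < d)%N & y *+ d \in A) ->
  (forall n : nat, exists2 p, prime p /\ (exists2 u, u \notin A & u *+ p \in B)
     & (n < p)%N) ->
  (forall y : K, (forall n, y \in fact_multiples B n) -> y = 0) ->
  admits_metric_SSGP R K.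
Proof.
move=> Kc BA A_tors primes_unb B_sep.
have [x xK] := enumerate_cofinally Kc.
have [d dP] : {d : nat -> nat & forall j, (0 < d j)%N /\ x j *+ d j \in A}.
  apply: (@choice _ _ (fun j d => (0 < d)%N /\ x j *+ d \in A)) => j.
  by have [e] := A_tors (x j); exists e.
(* A prime above this bound exceeds [n.+1] and every [d j] with [j <= n], so it divides none of
   these [d j]. *)
pose b n := (\sum_(j < n.+1) d j + n.+1)%N.
have [p [p_good p_gt p_inj]] := choose_distinct b primes_unb.
have [u uP] : {u : nat * nat -> K & forall s,
    u s \notin A /\ u s *+ p s.1 s.2 \in B}.
  apply: (@choice _ _ (fun s u => u \notin A /\ u *+ p s.1 s.2 \in B)) => s.
  by have [_ [v]] := p_good s.1 s.2; exists v.
have x_local n i j : (j <= n)%N -> x j \in local_at A (p n i).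
  move=> jn; have [d_gt0 xdA] := dP j; apply: mem_local_at xdA.
  rewrite prime_coprime; last exact: (p_good n i).1.
  rewrite gtnNdvd// (leq_ltn_trans _ (p_gt n i))// /b.
  by rewrite (bigD1 (Ordinal (jn : j < n.+1)%N))//= -addnA leq_addr.
have p_gt' n i : (n.+1 < p n i)%N.
  by rewrite (leq_ltn_trans _ (p_gt n i))// leq_addl.
pose c n i := u (n, i) *+ n.+1`!.
have [||||y|y y0|N NP] := @group_norm_of_cost R K (has_cost x c).
- exact: has_cost0.
- exact: has_cost_ge0.
- exact: has_costN.
- exact: has_costD.
- by apply: has_cost_ex; have [n _] := xK y 0%N; exists n.
- have [n1 yn1] : exists n, y \notin fact_multiples B n.
    apply: contrapT => /forallNP yB; move/eqP: y0; apply; apply: B_sep => n.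
    by apply/negPn/negP; exact: yB.
  have [j _ xj] := xK y 0%N.
  exists (maxn n1 j).+1%:R^-1; first by rewrite invr_gt0.
  move=> a; apply: (@has_cost_ge _ A B x p (fun n i => u (n, i))
    _ _ _ _ _ _ _ _ _ _ j) => //.
  + by move=> n i; exact: (p_good n i).1.
  + by move=> n i; exact: (uP (n, i)).1.
  + by move=> n i; exact: (uP (n, i)).2.
  + by rewrite leq_maxr.
  + by apply: contra yn1; apply: fact_multiples_anti; rewrite leq_maxl.
apply: (@gpnorm_admits_metric_SSGP R K N) => y e e0.
(* Since [y] recurs in the enumeration, it is met at a stage with [1 / (n + 1) < e]. *)
have [n ne xn] := xK y (Num.truncn e^-1).
have nV : n.+1%:R^-1 < e.
  rewrite invf_plt ?posrE// (lt_le_trans (truncnS_gt _))//.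
  by rewrite ler_nat ltnS.
exists n.+2, (fun i => c n i); split => [i z|].
  by apply: le_lt_trans nV; apply: NP; exact: has_cost_cyclic.
by apply: le_lt_trans nV; apply: NP; rewrite -xn; exact: has_cost_error.
Qed.

(** * The two subgroups of [G * H] and the use of wideness *)

Definition int_first (m : nat) (G : zmodClosed 'rV[rat]_m) (H : zmodType) :
    {pred (subgroup_of G * H)%type} :=
  fun y => [forall j, \val y.1 ord0 j \is a Num.int].

Arguments int_first {m} G H _.

Lemma int_first_zmod_closed (m : nat) (G : zmodClosed 'rV[rat]_m)
    (H : zmodType) :
  zmod_closed (int_first G H).
Proof.
split=> [|y z /forallP yi /forallP zi]; apply/forallP => j.
  by rewrite [\val _](raddf0 \val) mxE rpred0.
by rewrite [\val _](GRing.valB y.1 z.1) !mxE rpredB.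
Qed.

HB.instance Definition _ (m : nat) (G : zmodClosed 'rV[rat]_m) (H : zmodType) :=
  GRing.isZmodClosed.Build _ (int_first G H) (int_first_zmod_closed G H).

(** The second component is zero because the factorial multiples of [H] may share nonzero elements,
    for instance when [H] is divisible and nonzero. *)
Definition int_first_null_second (m : nat) (G : zmodClosed 'rV[rat]_m)
    (H : zmodType) : {pred (subgroup_of G * H)%type} :=
  fun y => (y \in int_first G H) && (y.2 == 0).

Arguments int_first_null_second {m} G H _.

Lemma int_first_null_second_zmod_closed (m : nat) (G : zmodClosed 'rV[rat]_m)
    (H : zmodType) : zmod_closed (int_first_null_second G H).
Proof.
split=> [|y z /andP[yi /eqP y0] /andP[zi /eqP z0]]; apply/andP; split.
- exact: rpred0.
- by [].
- exact: rpredB.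
- by rewrite /= y0 z0 subr0.
Qed.

HB.instance Definition _ (m : nat) (G : zmodClosed 'rV[rat]_m) (H : zmodType) :=
  GRing.isZmodClosed.Build _ (int_first_null_second G H)
    (int_first_null_second_zmod_closed G H).

(** By Gauss, the denominator, prime to the numerator, divides [d] once it divides the numerator
    times [d]. *)
Lemma mulrn_int_denq (q : rat) (d : nat) :
  (q *+ d \is a Num.int) = (`|denq q| %| d)%N.
Proof.
apply/idP/idP => [/intrP[z qd]|/dvdnP[k ->]].
  have E : (numq q * d%:Z = z * denq q)%R.
    by apply: (@intr_inj rat); rewrite !intrM -qd numqE -mulr_natr mulrAC.
  have Ed : (`|numq q| * d = `|z| * `|denq q|)%N.
    by rewrite -[d]/`|d%:Z|%N -!abszM E.
  rewrite -(@Gauss_dvdr _ `|numq q|) ?Ed ?dvdn_mull//.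
  by rewrite coprime_sym coprime_num_den.
rewrite mulnC mulrnA rpredMn// -mulr_natr natr_absz gtr0_norm ?denq_gt0//.
by rewrite -numqE intr_int.
Qed.

Lemma int_first_mulrn (m : nat) (G : zmodClosed 'rV[rat]_m) (H : zmodType)
    (y : subgroup_of G * H) (d : nat) :
  (y *+ d \in int_first G H) = [forall j, (`|denq (\val y.1 ord0 j)| %| d)%N].
Proof.
apply: eq_forallb => j; rewrite -mulrn_int_denq -mulmxnE.
have -> : (y *+ d).1 = y.1 *+ d by exact: (raddfMn fst).
by rewrite (raddfMn \val).
Qed.

Lemma int_first_torsion (m : nat) (G : zmodClosed 'rV[rat]_m) (H : zmodType)
    (y : subgroup_of G * H) : exists2 d, (0 < d)%N & y *+ d \in int_first G H.
Proof.
exists (\prod_j `|denq (\val y.1 ord0 j)|)%N.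
  by rewrite prodn_gt0// => j; rewrite absz_gt0 denq_neq0.
by rewrite int_first_mulrn; apply/forallP => j; rewrite (bigD1 j)//= dvdn_mulr.
Qed.

Lemma wide_primes (m : nat) (G : zmodClosed 'rV[rat]_m) (H : zmodType)
    (n : nat) :
  wide [set` G] ->
  exists2 p, prime p /\ (exists2 u, u \notin int_first G H &
    u *+ p \in int_first_null_second G H) & (n < p)%N.
Proof.
(* The bound is [n.+2] so that the set of primes contains [2]: [Qpi set0] is not
   the integers. *)
move=> [_ /(_ [set p | prime p /\ (p <= n.+2)%N])[]].
- by apply: (@sub_finite_set _ _ `I_n.+3); [move=> p []|exact: finite_II].
- by move=> p [].
move=> g [gG /existsNP[j]]; rewrite /Qpi /= ifN; last first.
  by apply/set0P; exists 2.
move=> /existsNP[p /not_implyP[p_pr /not_implyP[pd /not_andP[//|/negP]]]].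
rewrite -ltnNge => np; exists p; last by lia.
split=> //; pose y : subgroup_of G * H := (Subgroup gG, 0).
have := int_first_torsion y => -[d0 d0_gt0 d0y].
(* Here [d] is the order of [y] modulo [int_first G H]. As [p] divides it, [d / p] times [y] lies
   outside by minimality, while [p] times that lies inside. *)
have [d /andP[d_gt0 dy] d_min] := @ex_minnP (fun d => (0 < d)%N &&
  (y *+ d \in int_first G H)) (ex_intro _ d0 (introT andP (conj d0_gt0 d0y))).
have /dvdnP[k dk] : (p %| d)%N.
  by move: dy; rewrite int_first_mulrn => /forallP/(_ j); apply: dvdn_trans.
exists (y *+ k).
  apply/negP => yk; have := d_min k; rewrite yk dk; have := prime_gt1 p_pr; nia.
rewrite -mulrnA -dk; apply/andP; split=> //.
by rewrite (raddfMn snd) mul0rn.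
Qed.

Lemma fact_multiples_eq0 (m : nat) (G : zmodClosed 'rV[rat]_m) (H : zmodType)
    (y : subgroup_of G * H) :
  (forall n, y \in fact_multiples (int_first_null_second G H) n) -> y = 0.
Proof.
move=> yn.
have coordE j n : exists2 z : int, \val y.1 ord0 j = z%:~R & (n.+1 %| `|z|)%N.
  have /asboolP[b /andP[/forallP/(_ j)/intrP[z bz] _] ->] := yn n.
  exists (z *+ n.+1`!); last first.
    by rewrite -mulr_natr abszM/= natz dvdn_mull// dvdn_fact// leqnn.
  rewrite (raddfMn fst) (raddfMn \val) mulmxnE bz.
  by rewrite rmorphMn.
have y1 : y.1 = 0.
  apply: val_inj; rewrite (raddf0 \val); apply/rowP => j; rewrite mxE.
  have [z zE _] := coordE j 0%N.
  (* The index [|z|] is chosen so that [|z| + 1] divides [|z|], which forces [z = 0]. *)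
  have [z' z'E zd] := coordE j `|z|%N.
  have zz' : z = z' by apply: (@intr_inj rat); rewrite -zE.
  rewrite zE; suff -> : z = 0 by [].
  apply/eqP; rewrite -absz_eq0; case: posnP => // z0.
  by move: zd; rewrite -zz' gtnNdvd.
have /asboolP[b /andP[_ /eqP b2] yE] := yn 0%N.
have y2 : y.2 = 0 by rewrite yE (raddfMn snd) /= b2 mul0rn.
by case: y y1 y2 {yn coordE yE} => ? ? /= -> ->.
Qed.

Lemma subgroup_prod_countable (m : nat) (G : zmodClosed 'rV[rat]_m)
    (H : zmodType) :
  countable [set: H] -> countable [set: (subgroup_of G * H)%type].
Proof.
move=> /countable_injP[f f_inj]; apply/countable_injP.
exists (fun y => pickle (\val y.1, f y.2)) => -[y h] [y' h'] _ _ /=.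
move=> /(pcan_inj pickleK)[/val_inj -> fh].
by congr pair; apply: f_inj fh; rewrite inE.
Qed.

Theorem theorem9p2 (R : realType) (m : nat) (m_gt0 : (0 < m)%N)
    (G : zmodClosed 'rV[rat]_m) (G_wide : wide [set` G])
    (H : zmodType) (H_countable : countable [set: H]) :
  admits_metric_SSGP R (subgroup_of G * H)%type.
Proof.
apply: (@admits_metric_SSGP_criterion R _ (int_first G H)
  (int_first_null_second G H)).
- exact: subgroup_prod_countable.
- by move=> y /andP[].
- exact: int_first_torsion.
- by move=> n; exact: wide_primes.
- exact: fact_multiples_eq0.
Qed.
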